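(* Let $\mathcal A_q$ be the current algebra associated with the $q$-Onsager algebra, and let $A=\mathcal W_0\in\mathcal A_q$. Then the algebra $\mathcal A_q$ is $A$-standard.
   Context: Let $\mathbb F$ be a field and fix $0\neq q\in\mathbb F$ that is not a root of unity. Algebras are associative with $1$; $\mathbb N=\{0,1,2,\ldots\}$. The current algebra $\mathcal A_q$ is the $\mathbb F$-algebra with generators $\mathcal W_{-k},\ \mathcal W_{k+1},\ \mathcal G_{k+1},\ \tilde{\mathcal G}_{k+1}$ ($k\in\mathbb N$) and the following relations, for all $k,\ell\in\mathbb N$, where $\rho=-(q^2-q^{-2})^2$, $[X,Y]=XY-YX$ and $[X,Y]_q=qXY-q^{-1}YX$: $$[\mathcal W_0,\mathcal W_{k+1}]=[\mathcal W_{-k},\mathcal W_1]=(\tilde{\mathcal G}_{k+1}-\mathcal G_{k+1})/(q+q^{-1}),$$ $$[\mathcal W_0,\mathcal G_{k+1}]_q=[\tilde{\mathcal G}_{k+1},\mathcal W_0]_q=\rho\mathcal W_{-k-1}-\rho\mathcal W_{k+1},$$ $$[\mathcal G_{k+1},\mathcal W_1]_q=[\mathcal W_1,\tilde{\mathcal G}_{k+1}]_q=\rho\mathcal W_{k+2}-\rho\mathcal W_{-k},$$ $$[\mathcal W_{-k},\mathcal W_{-\ell}]=0,\qquad[\mathcal W_{k+1},\mathcal W_{\ell+1}]=0,$$ $$[\mathcal W_{-k},\mathcal W_{\ell+1}]+[\mathcal W_{k+1},\mathcal W_{-\ell}]=0,$$ $$[\mathcal W_{-k},\mathcal G_{\ell+1}]+[\mathcal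 G_{k+1},\mathcal W_{-\ell}]=0,$$ $$[\mathcal W_{-k},\tilde{\mathcal G}_{\ell+1}]+[\tilde{\mathcal G}_{k+1},\mathcal W_{-\ell}]=0,$$ $$[\mathcal W_{k+1},\mathcal G_{\ell+1}]+[\mathcal G_{k+1},\mathcal W_{\ell+1}]=0,$$ $$[\mathcal W_{k+1},\tilde{\mathcal G}_{\ell+1}]+[\tilde{\mathcal G}_{k+1},\mathcal W_{\ell+1}]=0,$$ $$[\mathcal G_{k+1},\mathcal G_{\ell+1}]=0,\qquad[\tilde{\mathcal G}_{k+1},\tilde{\mathcal G}_{\ell+1}]=0,$$ $$[\tilde{\mathcal G}_{k+1},\mathcal G_{\ell+1}]+[\mathcal G_{k+1},\tilde{\mathcal G}_{\ell+1}]=0.$$ For an $\mathbb F$-algebra $\mathcal A$, an element $A\in\mathcal A$ and $r\in\mathbb Z$, $\mathrm{ad}_rA:\mathcal A\to\mathcal A$ is the $\mathbb F$-linear map $X\mapsto q^rAX-q^{-r}XA$, and $\mathrm{ad}\,A=\mathrm{ad}_0A$. These maps mutually commute; products of maps are compositions and $I$ is the identity map. Define $$\mathrm{bad}_0A=\frac{\mathrm{ad}\,A}{q-q^{-1}},\qquad \mathrm{bad}_nA=\frac{(q^{2n}-q^{-2n})^2I+(\mathrm{ad}_nA)(\mathrm{ad}_{-n}A)}{(q^{2n}-q^{-2n})(q^{2n+1}-q^{-2n-1})}\quad(n\ge1),$$ $$(\mathrm{bad}\,A)_n=\prod_{i=0}^{n-1}\mathrm{bad}_iA\quad(n\ge0),\qquad(\mathrm{bad}\,A)_0=I.$$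 An element $X\in\mathcal A$ is $A$-standard if $(\mathrm{bad}\,A)_n(X)=0$ for some positive integer $n$; the algebra $\mathcal A$ is $A$-standard if each of its elements is $A$-standard. *)

(* Defs.v *)
From HB Require Import structures.
From mathcomp Require Import all_boot all_order all_algebra.
From mathcomp Require Import boolp.
From mathcomp Require Import monalg.

Set Implicit Arguments.
Unset Strict Implicit.
Unset Printing Implicit Defensive.

Import GRing.Theory.
Local Open Scope ring_scope.
Local Open Scope quotient_scope.

(* The free unital associative algebra. monalg provides only its left algebra
   structure: there, {malg F[K]} is an algebra only for commutative K, so a
   separate type name is needed to carry the algebra structure here. *)
Definition free_alg (F : fieldType) (I : choiceType) : Type :=
  {malg F[{fmonom I}]}.

Section FreeAlgebra.
Variables (F : fieldType) (I : choiceType).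

HB.instance Definition _ := GRing.Lalgebra.on (free_alg F I).

Fact free_alg_scalerAr (c : F) (x y : free_alg F I) :
  c *: (x * y) = x * (c *: y).
Proof.
have scaleE (z : free_alg F I) : c *: z = c%:MP * z by rewrite [RHS]mul_malgC.
have commC (z : {malg F[{fmonom I}]}) : z * c%:MP = c%:MP * z.
  rewrite !malgM_def fgmulgU fgmulUg; apply: eq_bigr => k _.
  by rewrite mulm1 mul1m mulrC.
by rewrite !scaleE !mulrA [x * _]commC.
Qed.

HB.instance Definition _ :=
  GRing.Lalgebra_isAlgebra.Build F (free_alg F I) free_alg_scalerAr.

Definition free_gen (i : I) : free_alg F I := << fmu i >>.

Definition free_const (x : free_alg F I) : F := mcoeff (mone : {fmonom I}) x.

Lemma free_const_gen i : free_const (free_gen i) = 0.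
Proof.
rewrite /free_const /free_gen mcoeffU; case: eqP => // /(congr1 (@fmonom_val _)).
by rewrite fm1 fmuE.
Qed.

Lemma free_const0 : free_const 0 = 0. Proof. exact: mcoeff0. Qed.

Lemma free_const1 : free_const 1 = 1. Proof. exact: rmorph1. Qed.

Lemma free_constD x y : free_const (x + y) = free_const x + free_const y.
Proof. exact: mcoeffD. Qed.

Lemma free_constN x : free_const (- x) = - free_const x.
Proof. exact: mcoeffN. Qed.

Lemma free_constM x y : free_const (x * y) = free_const x * free_const y.
Proof. exact: (rmorphM (mcoeff (mone : {fmonom I}))). Qed.

Lemma free_constZ c x : free_const (c *: x) = c * free_const x.
Proof. exact: mcoeffZ. Qed.

End FreeAlgebra.

(* ring_quotient only equips quotients of commutative rings with a product.
   Properness is required because an algType is nontrivial. Stability under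
   scaling follows from ideal_mull, as c *: x = c%:A * x. *)
Record two_sided_ideal (F : fieldType) (B : algType F) := TwoSidedIdeal {
  ideal_pred :> zmodClosed B;
  ideal_mull : forall a x : B, x \in ideal_pred -> a * x \in ideal_pred;
  ideal_mulr : forall a x : B, x \in ideal_pred -> x * a \in ideal_pred;
  ideal_proper : 1 \notin ideal_pred }.

Definition alg_quot (F : fieldType) (B : algType F) (I : two_sided_ideal B) : Type :=
  Quotient.quot I.

Section AlgebraQuotient.
Variables (F : fieldType) (B : algType F) (I : two_sided_ideal B).

Local Notation Q := (alg_quot I).

HB.instance Definition _ := GRing.Zmodule.on Q.
HB.instance Definition _ := EqQuotient.on Q.

Definition alg_proj (x : B) : Q := \pi_Q x.

Lemma alg_projP x y : reflect (alg_proj x = alg_proj y) (x - y \in (I : zmodClosed B)).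
Proof. by rewrite Quotient.idealrBE; apply: eqP. Qed.

Lemma alg_proj_repr (u : Q) : alg_proj (repr u) = u.
Proof. exact: reprK. Qed.

Lemma alg_projW (P : Q -> Prop) : (forall x, P (alg_proj x)) -> forall u, P u.
Proof. by move=> H u; rewrite -[u]alg_proj_repr. Qed.

Lemma alg_projD x y : alg_proj (x + y) = alg_proj x + alg_proj y.
Proof. exact: Quotient.pi_add. Qed.

Lemma alg_proj0 : alg_proj 0 = 0.
Proof. by apply: (addIr (alg_proj 0)); rewrite -alg_projD !add0r. Qed.

Definition alg_quot_one : Q := alg_proj 1.

Definition alg_quot_mul (u v : Q) : Q := alg_proj (repr u * repr v).

Definition alg_quot_scale (c : F) (u : Q) : Q := alg_proj (c *: repr u).

Fact alg_quot_mulE x y : alg_quot_mul (alg_proj x) (alg_proj y) = alg_proj (x * y).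
Proof.
apply/alg_projP; set x' := repr _; set y' := repr _.
have Hx : x' - x \in (I : zmodClosed B) by apply/alg_projP; rewrite alg_proj_repr.
have Hy : y' - y \in (I : zmodClosed B) by apply/alg_projP; rewrite alg_proj_repr.
have -> : x' * y' - x * y = x' * (y' - y) + (x' - x) * y.
  by rewrite mulrBr mulrBl addrA subrK.
by apply: rpredD; [apply: ideal_mull|apply: ideal_mulr].
Qed.

Fact alg_quot_scaleE c x : alg_quot_scale c (alg_proj x) = alg_proj (c *: x).
Proof.
apply/alg_projP; set x' := repr _.
have Hx : x' - x \in (I : zmodClosed B) by apply/alg_projP; rewrite alg_proj_repr.
by rewrite -scalerBr -[x' - x]mul1r scalerAl ideal_mull.
Qed.

Fact alg_quot_mulA : associative alg_quot_mul.
Proof.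
elim/alg_projW=> x; elim/alg_projW=> y; elim/alg_projW=> z.
by rewrite !alg_quot_mulE mulrA.
Qed.

Fact alg_quot_mul1q : left_id alg_quot_one alg_quot_mul.
Proof. by elim/alg_projW=> x; rewrite alg_quot_mulE mul1r. Qed.

Fact alg_quot_mulq1 : right_id alg_quot_one alg_quot_mul.
Proof. by elim/alg_projW=> x; rewrite alg_quot_mulE mulr1. Qed.

Fact alg_quot_mulDl : left_distributive alg_quot_mul +%R.
Proof.
elim/alg_projW=> x; elim/alg_projW=> y; elim/alg_projW=> z.
by rewrite -alg_projD !alg_quot_mulE -alg_projD mulrDl.
Qed.

Fact alg_quot_mulDr : right_distributive alg_quot_mul +%R.
Proof.
elim/alg_projW=> x; elim/alg_projW=> y; elim/alg_projW=> z.
by rewrite -alg_projD !alg_quot_mulE -alg_projD mulrDr.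
Qed.

Fact alg_quot_one_neq0 : alg_quot_one != 0.
Proof.
rewrite -alg_proj0.
by apply/negP => /eqP /alg_projP; rewrite subr0; apply/negP/ideal_proper.
Qed.

HB.instance Definition _ := GRing.Zmodule_isNzRing.Build Q alg_quot_mulA
  alg_quot_mul1q alg_quot_mulq1 alg_quot_mulDl alg_quot_mulDr alg_quot_one_neq0.

Fact alg_quot_scaleA a b u :
  alg_quot_scale a (alg_quot_scale b u) = alg_quot_scale (a * b) u.
Proof. by elim/alg_projW: u => x; rewrite !alg_quot_scaleE scalerA. Qed.

Fact alg_quot_scale1 : left_id 1 alg_quot_scale.
Proof. by elim/alg_projW=> x; rewrite alg_quot_scaleE scale1r. Qed.

Fact alg_quot_scaleDr : right_distributive alg_quot_scale +%R.
Proof.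
move=> c; elim/alg_projW=> x; elim/alg_projW=> y.
by rewrite -alg_projD !alg_quot_scaleE -alg_projD scalerDr.
Qed.

Fact alg_quot_scaleDl u : {morph alg_quot_scale^~ u : a b / a + b}.
Proof.
elim/alg_projW: u => x a b.
by rewrite /= !alg_quot_scaleE -alg_projD scalerDl.
Qed.

HB.instance Definition _ := GRing.Zmodule_isLmodule.Build F Q
  alg_quot_scaleA alg_quot_scale1 alg_quot_scaleDr alg_quot_scaleDl.

Lemma alg_projM x y : alg_proj (x * y) = alg_proj x * alg_proj y.
Proof. exact/esym/alg_quot_mulE. Qed.

Lemma alg_proj1 : alg_proj 1 = 1. Proof. by []. Qed.

Lemma alg_projZ c x : alg_proj (c *: x) = c *: alg_proj x.
Proof. exact/esym/alg_quot_scaleE. Qed.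

Fact alg_quot_scaleAl (c : F) (u v : Q) : c *: (u * v) = (c *: u) * v.
Proof.
elim/alg_projW: u => x; elim/alg_projW: v => y.
by rewrite -alg_projM -!alg_projZ -alg_projM scalerAl.
Qed.

HB.instance Definition _ := GRing.Lmodule_isLalgebra.Build F Q alg_quot_scaleAl.

Fact alg_quot_scaleAr (c : F) (u v : Q) : c *: (u * v) = u * (c *: v).
Proof.
elim/alg_projW: u => x; elim/alg_projW: v => y.
by rewrite -alg_projM -!alg_projZ -alg_projM scalerAr.
Qed.

HB.instance Definition _ := GRing.Lalgebra_isAlgebra.Build F Q alg_quot_scaleAr.

End AlgebraQuotient.

Section GeneratedIdeal.
Variables (F : fieldType) (B : algType F) (rel : B -> B -> Prop).

(* The two-sided ideal generated by the differences l - r with rel l r. *)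
Inductive in_gen_ideal : B -> Prop :=
| gen_ideal_rel l r : rel l r -> in_gen_ideal (l - r)
| gen_ideal_0 : in_gen_ideal 0
| gen_ideal_sub x y : in_gen_ideal x -> in_gen_ideal y -> in_gen_ideal (x - y)
| gen_ideal_mull a x : in_gen_ideal x -> in_gen_ideal (a * x)
| gen_ideal_mulr a x : in_gen_ideal x -> in_gen_ideal (x * a).

Definition gen_ideal : {pred B} := fun x => `[< in_gen_ideal x >].

Lemma gen_idealP x : reflect (in_gen_ideal x) (x \in gen_ideal).
Proof. exact: asboolP. Qed.

Fact gen_ideal_zmod_closed : zmod_closed gen_ideal.
Proof.
split; first exact/gen_idealP/gen_ideal_0.
by move=> x y /gen_idealP Hx /gen_idealP Hy; apply/gen_idealP/gen_ideal_sub.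
Qed.

HB.instance Definition _ :=
  GRing.isZmodClosed.Build B gen_ideal gen_ideal_zmod_closed.

Fact gen_ideal_closed_mull a x : x \in gen_ideal -> a * x \in gen_ideal.
Proof. by move=> /gen_idealP Hx; apply/gen_idealP/gen_ideal_mull. Qed.

Fact gen_ideal_closed_mulr a x : x \in gen_ideal -> x * a \in gen_ideal.
Proof. by move=> /gen_idealP Hx; apply/gen_idealP/gen_ideal_mulr. Qed.

Definition gen_two_sided_ideal (proper : 1 \notin gen_ideal) : two_sided_ideal B :=
  @TwoSidedIdeal F B gen_ideal gen_ideal_closed_mull gen_ideal_closed_mulr proper.

End GeneratedIdeal.

Section Commutators.
Variables (F : fieldType) (q : F) (A : algType F).

Definition commutator (X Y : A) : A := X * Y - Y * X.

Definition q_commutator (X Y : A) : A := q *: (X * Y) - q^-1 *: (Y * X).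

End Commutators.

(* The alternating generators: [genWm k] is $\mathcal W_{-k}$ and [genWp k],
   [genG k], [genGt k] are $\mathcal W_{k+1}$, $\mathcal G_{k+1}$,
   $\tilde{\mathcal G}_{k+1}$. *)
Inductive current_gen : Type :=
  genWm of nat | genWp of nat | genG of nat | genGt of nat.

Definition current_gen_code (g : current_gen) : nat * nat :=
  match g with
  | genWm k => (0, k) | genWp k => (1, k) | genG k => (2, k) | genGt k => (3, k)
  end%N.

Definition current_gen_decode (c : nat * nat) : option current_gen :=
  match c with
  | (0, k) => Some (genWm k) | (1, k) => Some (genWp k)
  | (2, k) => Some (genG k) | (3, k) => Some (genGt k)
  | _ => None
  end%N.

Fact current_gen_codeK : pcancel current_gen_code current_gen_decode.
Proof. by case. Qed.

HB.instance Definition _ := Countable.copy current_gen (pcan_type current_gen_codeK).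

Section CurrentAlgebra.
Variables (F : fieldType) (q : F).

Local Notation free := (free_alg F current_gen).
Local Notation Wm k := (free_gen F (genWm k)).
Local Notation Wp k := (free_gen F (genWp k)).
Local Notation G k := (free_gen F (genG k)).
Local Notation Gt k := (free_gen F (genGt k)).
Local Notation "[[ x , y ]]" := (commutator x y).
Local Notation "[[ x , y ]]_q" := (q_commutator q x y).

Definition rho : F := - (q ^+ 2 - q ^- 2) ^+ 2.

Inductive current_rel : free -> free -> Prop :=
| rel_W0_Wp k :
    current_rel [[Wm 0, Wp k]] [[Wm k, Wp 0]]
| rel_Wm_W1 k :
    current_rel [[Wm k, Wp 0]] ((q + q^-1)^-1 *: (Gt k - G k))
| rel_W0_G k :
    current_rel [[Wm 0, G k]]_q [[Gt k, Wm 0]]_q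
| rel_Gt_W0 k :
    current_rel [[Gt k, Wm 0]]_q (rho *: Wm k.+1 - rho *: Wp k)
| rel_G_W1 k :
    current_rel [[G k, Wp 0]]_q [[Wp 0, Gt k]]_q
| rel_W1_Gt k :
    current_rel [[Wp 0, Gt k]]_q (rho *: Wp k.+1 - rho *: Wm k)
| rel_Wm_Wm k l :
    current_rel [[Wm k, Wm l]] 0
| rel_Wp_Wp k l :
    current_rel [[Wp k, Wp l]] 0
| rel_Wm_Wp k l :
    current_rel ([[Wm k, Wp l]] + [[Wp k, Wm l]]) 0
| rel_Wm_G k l :
    current_rel ([[Wm k, G l]] + [[G k, Wm l]]) 0
| rel_Wm_Gt k l :
    current_rel ([[Wm k, Gt l]] + [[Gt k, Wm l]]) 0
| rel_Wp_G k l :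
    current_rel ([[Wp k, G l]] + [[G k, Wp l]]) 0
| rel_Wp_Gt k l :
    current_rel ([[Wp k, Gt l]] + [[Gt k, Wp l]]) 0
| rel_G_G k l :
    current_rel [[G k, G l]] 0
| rel_Gt_Gt k l :
    current_rel [[Gt k, Gt l]] 0
| rel_Gt_G k l :
    current_rel ([[Gt k, G l]] + [[G k, Gt l]]) 0.

(* Every relator has zero constant term. *)
Fact current_ideal_const x : in_gen_ideal current_rel x -> free_const x = 0.
Proof.
have B0 y z : free_const y = 0 -> free_const z = 0 -> free_const (y - z) = 0.
  by move=> Hy Hz; rewrite free_constD free_constN Hy Hz subr0.
have D0 y z : free_const y = 0 -> free_const z = 0 -> free_const (y + z) = 0.
  by move=> Hy Hz; rewrite free_constD Hy Hz addr0.
have Z0 c y : free_const y = 0 -> free_const (c *: y) = 0.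
  by move=> Hy; rewrite free_constZ Hy mulr0.
have Ml a y : free_const y = 0 -> free_const (a * y) = 0.
  by move=> Hy; rewrite free_constM Hy mulr0.
have Mr a y : free_const y = 0 -> free_const (y * a) = 0.
  by move=> Hy; rewrite free_constM Hy mul0r.
have comm0 g h : free_const [[free_gen F g, free_gen F h]] = 0.
  by apply: B0; apply: Ml; apply: free_const_gen.
have qcomm0 g h : free_const [[free_gen F g, free_gen F h]]_q = 0.
  by apply: B0; apply: Z0; apply: Ml; apply: free_const_gen.
have Wm_rhs c g h : free_const (c *: (free_gen F g - free_gen F h)) = 0.
  by apply: Z0; apply: B0; apply: free_const_gen.
have rho_rhs g h : free_const (rho *: free_gen F g - rho *: free_gen F h) = 0.
  by apply: B0; apply: Z0; apply: free_const_gen.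
have sum0 f g h i :
    free_const ([[free_gen F f, free_gen F g]] + [[free_gen F h, free_gen F i]]) = 0.
  by apply: D0; apply: comm0.
have z0 := free_const0 F current_gen.
have rel0 l r : current_rel l r -> free_const l = 0 /\ free_const r = 0.
  case=> *; split.
  exact: comm0. exact: comm0.
  exact: comm0. exact: Wm_rhs.
  exact: qcomm0. exact: qcomm0.
  exact: qcomm0. exact: rho_rhs.
  exact: qcomm0. exact: qcomm0.
  exact: qcomm0. exact: rho_rhs.
  exact: comm0. exact: z0.
  exact: comm0. exact: z0.
  exact: sum0. exact: z0.
  exact: sum0. exact: z0.
  exact: sum0. exact: z0.
  exact: sum0. exact: z0.
  exact: sum0. exact: z0.
  exact: comm0. exact: z0.
  exact: comm0. exact: z0.
  exact: sum0. exact: z0.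
elim=> {x}.
- by move=> l r /rel0[Hl Hr]; apply: B0.
- exact: free_const0.
- by move=> x y _ Hx _ Hy; apply: B0.
- by move=> a x _ Hx; apply: Ml.
- by move=> a x _ Hx; apply: Mr.
Qed.

Fact current_ideal_proper : 1 \notin gen_ideal current_rel.
Proof.
apply/negP => /gen_idealP /current_ideal_const /eqP.
by rewrite free_const1 oner_eq0.
Qed.

Definition current_ideal : two_sided_ideal free :=
  gen_two_sided_ideal current_ideal_proper.

Definition current_algebra : Type := alg_quot current_ideal.

HB.instance Definition _ := GRing.Algebra.on current_algebra.

Definition current_proj (x : free) : current_algebra := alg_proj current_ideal x.

Definition current_Wm (k : nat) : current_algebra := current_proj (Wm k).
Definition current_Wp (k : nat) : current_algebra := current_proj (Wp k).
Definition current_G (k : nat) : current_algebra := current_proj (G k).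
Definition current_Gt (k : nat) : current_algebra := current_proj (Gt k).

End CurrentAlgebra.

Section Standard.
Variables (F : fieldType) (q : F) (A : algType F).

Definition ad (r : int) (a : A) : A -> A :=
  fun X => q ^ r *: (a * X) - q ^ (- r) *: (X * a).

Definition bad (n : nat) (a : A) : A -> A :=
  if n is 0 then fun X => (q - q^-1)^-1 *: ad 0 a X
  else fun X =>
    ((q ^+ (2 * n) - q ^- (2 * n)) * (q ^+ (2 * n + 1) - q ^- (2 * n + 1)))^-1 *:
      ((q ^+ (2 * n) - q ^- (2 * n)) ^+ 2 *: X + ad n a (ad (- n%:Z) a X)).

Definition bad_prod (a : A) (n : nat) : A -> A :=
  \big[comp/idfun]_(0 <= i < n) bad i a.

Definition standard_elt (a X : A) : Prop :=
  exists n : nat, (0 < n)%N /\ bad_prod a n X = 0.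

Definition standard_algebra (a : A) : Prop := forall X : A, standard_elt a X.

End Standard.

(* Main.v *)
Require Import Defs.
From mathcomp Require Import all_boot all_order all_algebra.
From HB Require Import structures.
From mathcomp Require Import boolp functions finmap monalg ring.

Set Implicit Arguments.
Unset Strict Implicit.
Unset Printing Implicit Defensive.

Import GRing.Theory.

Local Open Scope ring_scope.

(** Write L and R for left and right multiplication by A = W_0, put t = q^2 and
    theta(x) = x + x^-1.  Up to a scalar, bad_n A is, for n >= 1 and u = t^n,
    the operator
      L^2 + R^2 - (u + u^-1) L R + (u - u^-1)^2,
    which for R = theta(x) is the product of L - theta(u x) and
    L - theta(u^-1 x); and bad_0 A is L - R.  So (bad A)_n kills X when X moves
    the eigenvalue theta(x) of A only to the eigenvalues theta(t^i x) with
    |i| < n, that is, by less than n steps.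

    If X and Y move these eigenvalues by less than n steps and by at most one
    step, then X Y moves them by at most n steps.  This heuristic becomes a
    proof ([prod_opM]) once it is an ideal membership in the polynomial ring in
    three variables a, b, c, which stand for A placed left of X, between X and
    Y, and right of Y: with Q_n(x, y) the polynomial of (bad A)_n, up to a
    scalar, some nonzero multiple of Q_(n+1)(a, c) lies in the ideal generated
    by Q_n(a, b) and Q_2(b, c).  The cofactor of Q_n(a, b) is quadratic and
    explicit ([cofactor]), so that the membership ([prod_factor_mem]) follows by
    induction on n from two polynomial identities.  To let the membership act
    on products X Y, the sequences j |-> X A^j Y are put in a module over the
    ring of polynomials in a, b, c ([triple_module]).

    It remains to treat the generators.  The defining relations imply that
    (bad A)_2 kills each of them ([prod_op2_gen]): W_(-k) commutes with A, and
    the relations between A and W_(k+1), G_(k+1), Gt_(k+1) close up after two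
    steps.  Hence (bad A)_(m+2) kills every word of length m ([prod_op_word]),
    and every element of the algebra is a linear combination of words. *)

(** * The polynomials of the factors and an ideal membership *)

Section FactorPolynomials.
Variables (K : comNzRingType) (t : K).

(** If y = z + z^-1, this is u^2 (x - u z - (u z)^-1) (x - u^-1 z - u z^-1).
    The factor u^2 clears the denominators, so that the identities below make
    sense in every commutative ring. *)
Definition quad (u x y : K) : K :=
  u ^+ 2 * (x ^+ 2 + y ^+ 2) - u * (u ^+ 2 + 1) * (x * y) + (u ^+ 2 - 1) ^+ 2.

(** The index 0 is special because [quad 1 x y] is the square of x - y. *)
Definition factor (i : nat) (x y : K) : K :=
  if i is 0 then x - y else quad (t ^+ i) x y.

(** Put theta(x) = x + x^-1 and u = t^n, and let Q_n be the product of the first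
    n factors.  The curve (b - c) * quad t b c = 0 contains the component b = c,
    on which the quotient of Q_(n+1)(a, c) by Q_n(a, b) is [quad u a b], and the
    component b = theta(x), c = theta(t x).  On the latter Q_n(a, b) is a
    multiple of the product of the a - theta(t^i x) with |i| < n, and
    Q_(n+1)(a, c) of the product of the a - theta(t^(i+1) x) with |i| <= n, so
    that the quotient is a multiple of (a - theta(u x)) (a - theta(u t x)).  The
    polynomial below interpolates between these two quotients; the factor
    (t + 1) * (t - 1) ^+ 2 clears the denominators of the interpolation. *)
Definition cofactor (u a b c : K) : K :=
  u ^+ 2 * (t + 1) * (t - 1) ^+ 2 * a ^+ 2
  - u * (t ^+ 2 - 1) * ((t - u ^+ 2) * b + (u ^+ 2 * t - 1) * c) * a
  + t * (u ^+ 2 - 1) * (u ^+ 2 - t) * b ^+ 2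
  + t * (u ^+ 2 - 1) * (u ^+ 2 * t - 1) * c ^+ 2
  + (t + 1) * (u ^+ 2 * t - 1) * (t - u ^+ 2) * (b * c)
  + (t + 1) * (t - 1) ^+ 2 * (u ^+ 2 - 1) ^+ 2.

Lemma cofactor_base a b c :
  (t + 1) * (t - 1) ^+ 2 * (quad t a c * (a - c)) =
  cofactor t a b c * (a - b) + (t + 1) * (t - 1) ^+ 2 * ((b - c) * quad t b c).
Proof. by rewrite /quad /cofactor; ring. Qed.

(** On both components of (b - c) * quad t b c = 0 the two sides have the same
    linear factors in a, hence they agree modulo this polynomial. *)
Lemma cofactor_step v a b c :
  quad (v * t) a c * cofactor v a b c =
  cofactor (v * t) a b c * quad v a b +
  (t * v ^+ 2 - 1) * (v * (t ^+ 2 * v ^+ 4 - 1) * a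
     - v ^+ 2 * (t ^+ 2 * v ^+ 2 - 1) * b - t * v ^+ 2 * (v ^+ 2 - 1) * c)
   * ((b - c) * quad t b c).
Proof. by rewrite /quad /cofactor; ring. Qed.

Lemma prod_factor_mem n a b c : (0 < n)%N ->
  exists h : K, (t + 1) * (t - 1) ^+ 2 * \prod_(0 <= i < n.+1) factor i a c =
    cofactor (t ^+ n) a b c * (\prod_(0 <= i < n) factor i a b) +
    h * (\prod_(0 <= i < 2) factor i b c).
Proof.
have Q2 : \prod_(0 <= i < 2) factor i b c = (b - c) * quad t b c.
  by rewrite unlock /= expr1 mulr1.
rewrite Q2; elim: n => [//|[_ _|n /(_ isT)[h IHh] _]].
  exists ((t + 1) * (t - 1) ^+ 2).
  by rewrite unlock /= !mulr1 expr1 -cofactor_base [_ * quad _ _ _]mulrC.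
set v := t ^+ n.+1 in IHh; set C := cofactor _ _ _ _ in IHh.
set r := _ * quad t b c in IHh *.
(* The coefficient of the last term of [cofactor_step]. *)
pose k := (t * v ^+ 2 - 1) * (v * (t ^+ 2 * v ^+ 4 - 1) * a
  - v ^+ 2 * (t ^+ 2 * v ^+ 2 - 1) * b - t * v ^+ 2 * (v ^+ 2 - 1) * c).
exists (h * quad (v * t) a c + k * \prod_(0 <= i < n.+1) factor i a b).
rewrite big_nat_recr //= mulrA IHh [in RHS]big_nat_recr //= exprSr -/v.
have step := cofactor_step v a b c; rewrite -/C -/k -/r in step.
have -> x P q : (C * P + h * x) * q = q * C * P + h * q * x by ring.
rewrite step; ring.
Qed.

End FactorPolynomials.

(** * The operators of the factors, and pairings of X with Y *)

Section FactorOperators.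
Variables (F : fieldType) (B : algType F) (A : B) (t : F).

Definition quad_op (u : F) (X : B) : B :=
  u ^+ 2 *: (A * (A * X) + X * A * A) - (u * (u ^+ 2 + 1)) *: (A * (X * A))
  + (u ^+ 2 - 1) ^+ 2 *: X.

Definition factor_op (i : nat) (X : B) : B :=
  if i is 0 then A * X - X * A else quad_op (t ^+ i) X.

Definition prod_op (n : nat) (X : B) : B := foldr factor_op X (iota 0 n).

(** The properties of the map (X, Y) |-> (j |-> X A^j Y) and of the value at
    j = 0 that the proof uses.  Stating them for an arbitrary module M over an
    arbitrary commutative ring K keeps the computations away from the concrete
    polynomial ring in three variables. *)
Section Pairing.
Variables (K : comNzRingType) (k : {rmorphism F -> K}) (M : lmodType K).
Variables (a b c : K).

Lemma quad_scale u x y (s : M) : quad (k u) x y *: s =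
  k (u ^+ 2) *: (x *: (x *: s) + y *: (y *: s))
  - k (u * (u ^+ 2 + 1)) *: (x *: (y *: s)) + k ((u ^+ 2 - 1) ^+ 2) *: s.
Proof.
rewrite !(rmorphXn, rmorphM, rmorphB, rmorphD, rmorph1) /quad scalerDl scalerBl.
by rewrite -!scalerA [(x ^+ 2 + _) *: s]scalerDl !expr2 -!scalerA.
Qed.

(** f turns left and right multiplication by A into the scalars x and y. *)
Definition intertwines (f : B -> M) x y := [/\ zmod_morphism f,
  forall e X, f (e *: X) = k e *: f X, forall X, f (A * X) = x *: f X
  & forall X, f (X * A) = y *: f X].

Lemma intertwines_prod (f : B -> M) x y n X : intertwines f x y ->
  f (prod_op n X) = (\prod_(0 <= i < n) factor (k t) i x y) *: f X.
Proof.
case=> fB fZ fl fr.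
have f0 : f 0 = 0 by rewrite -(subrr 0) fB subrr.
have fD Y Z : f (Y + Z) = f Y + f Z.
  by rewrite -{1}[Z]opprK fB -[- Z]sub0r fB f0 sub0r opprK.
rewrite /prod_op /index_iota subn0.
elim: (iota 0 n) => [|i s IHs]; first by rewrite big_nil scale1r.
rewrite big_cons -scalerA -IHs /=; move: (foldr _ _ _) => Y.
case: i => [|i]; first by rewrite fB fl fr scalerBl.
by rewrite /= -rmorphXn quad_scale /quad_op fD fB !fZ fD !(fl, fr).
Qed.

Variables (tau : B -> B -> M) (ev : M -> B).
Hypothesis tau_l : forall Y, intertwines (tau^~ Y) a b.
Hypothesis tau_r : forall X, intertwines (tau X) b c.
Hypothesis ev_add : zmod_morphism ev.
Hypothesis ev_k : forall e s, ev (k e *: s) = e *: ev s.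
Hypothesis ev_a : forall s, ev (a *: s) = A * ev s.
Hypothesis ev_c : forall s, ev (c *: s) = ev s * A.
Hypothesis ev_tau : forall X Y, ev (tau X Y) = X * Y.

Lemma prod_op_ev n s :
  prod_op n (ev s) = ev ((\prod_(0 <= i < n) factor (k t) i a c) *: s).
Proof.
have ev0 : ev 0 = 0 by rewrite -(subrr 0) ev_add subrr.
have evD x y : ev (x + y) = ev x + ev y.
  by rewrite -{1}[y]opprK ev_add -[- y]sub0r ev_add ev0 sub0r opprK.
rewrite /prod_op /index_iota subn0; elim: (iota 0 n) => [|i l IHl].
  by rewrite big_nil scale1r.
rewrite big_cons -scalerA /= {}IHl; move: (_ *: s) => {}s.
case: i => [|i]; first by rewrite scalerBl ev_add ev_a ev_c.
by rewrite /= -rmorphXn quad_scale /quad_op evD ev_add !ev_k evD !(ev_a, ev_c).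
Qed.

(** Apply [prod_factor_mem] to [tau X Y] and then [ev]: the product of factors
    in (a, b) kills [tau X Y] because [prod_op n] kills X, and the one in (b, c)
    because [prod_op 2] kills Y. *)
Lemma prod_opM_pairing n X Y : (t + 1) * (t - 1) ^+ 2 != 0 -> (0 < n)%N ->
  prod_op n X = 0 -> prod_op 2 Y = 0 -> prod_op n.+1 (X * Y) = 0.
Proof.
move=> t_gen n_gt0 X0 Y0.
have tau0l Z : tau 0 Z = 0.
  by rewrite -(subrr 0); case: (tau_l Z) => -> _ _ _; rewrite subrr.
have tau0r Z : tau Z 0 = 0.
  by rewrite -(subrr 0); case: (tau_r Z) => -> _ _ _; rewrite subrr.
have ev0 : ev 0 = 0 by rewrite -(subrr 0) ev_add subrr.
have [h] := prod_factor_mem (k t) a b c n_gt0.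
have -> : (k t + 1) * (k t - 1) ^+ 2 = k ((t + 1) * (t - 1) ^+ 2).
  by rewrite rmorphM rmorphD rmorphXn rmorphB rmorph1.
move/(congr1 (fun p => ev (p *: tau X Y))); rewrite /= scalerDl -!scalerA.
rewrite -(intertwines_prod _ _ (tau_l Y)) -(intertwines_prod _ _ (tau_r X)).
rewrite X0 Y0 tau0l tau0r !scaler0 addr0 ev0.
rewrite ev_k -prod_op_ev ev_tau => /eqP.
by rewrite scaler_eq0 (negPf t_gen) => /eqP.
Qed.

End Pairing.
End FactorOperators.

(** * Modules over polynomial rings from commuting endomorphisms *)

(** An alias of V, so that the scalar action of {poly K} through u does not
    compete with the action of K. *)
Definition poly_module (K : comNzRingType) (V : lmodType K)
    (u : {linear V -> V}) : Type := V.

Section PolyModule.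
Variables (K : comNzRingType) (V : lmodType K) (u : {linear V -> V}).

HB.instance Definition _ := GRing.Zmodule.on (poly_module u).

Definition poly_scale (p : {poly K}) (v : V) : V :=
  \sum_(i < size p) p`_i *: iter i u v.

Lemma poly_scale_widen n (p : {poly K}) v : (size p <= n)%N ->
  poly_scale p v = \sum_(i < n) p`_i *: iter i u v.
Proof.
move=> le_pn; rewrite /poly_scale.
rewrite (big_ord_widen _ (fun i => p`_i *: iter i u v) le_pn).
rewrite big_mkcond; apply: eq_bigr => i _.
by case: ltnP => // le_pi; rewrite nth_default ?scale0r.
Qed.

Lemma iter_linear i : linear (iter i u).
Proof. by elim: i => [|i IHi] c v w /=; rewrite ?IHi ?linearP. Qed.

Fact poly_scaleDr : right_distributive poly_scale +%R.
Proof.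
move=> p v w; rewrite /poly_scale -big_split; apply: eq_bigr => i _ /=.
by rewrite -scalerDr -[v]scale1r iter_linear !scale1r.
Qed.

Fact poly_scaleDl v : {morph poly_scale^~ v : p r / p + r}.
Proof.
move=> p r; pose n := maxn (size (p + r)) (maxn (size p) (size r)).
rewrite !(@poly_scale_widen n) ?leq_max ?leqnn ?orbT // -big_split.
by apply: eq_bigr => i _; rewrite coefD scalerDl.
Qed.

Lemma poly_scaleC c v : poly_scale c%:P v = c *: v.
Proof. by rewrite (@poly_scale_widen 1) ?size_polyC_leq1 // big_ord1 coefC. Qed.

Lemma poly_scale_mulC c (p : {poly K}) v :
  poly_scale (c%:P * p) v = c *: poly_scale p v.
Proof.
rewrite (@poly_scale_widen (size p)) ?mul_polyC ?size_scale_leq //.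
by rewrite scaler_sumr; apply: eq_bigr => i _; rewrite coefZ scalerA.
Qed.

Lemma poly_scale_mulX (p : {poly K}) v :
  poly_scale (p * 'X) v = u (poly_scale p v).
Proof.
rewrite (@poly_scale_widen (size p).+1); last first.
  by rewrite (leq_trans (size_polyMleq _ _)) // size_polyX addn2.
rewrite big_ord_recl coefMX scale0r add0r raddf_sum; apply: eq_bigr => i _.
by rewrite coefMX /= linearZ_LR.
Qed.

Fact poly_scaleA p r v : poly_scale p (poly_scale r v) = poly_scale (p * r) v.
Proof.
have D0 w : poly_scale 0 w = 0 by rewrite /poly_scale size_poly0 big_ord0.
have Xcomm s w : u (poly_scale s w) = poly_scale s (u w).
  rewrite /poly_scale raddf_sum; apply: eq_bigr => i _; rewrite /= linearZ_LR.
  by rewrite -iterS iterSr.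
elim/poly_ind: p => [|p c IHp]; first by rewrite mul0r !D0.
rewrite mulrDl !poly_scaleDl poly_scale_mulC poly_scaleC; congr (_ + _).
by rewrite mulrAC !poly_scale_mulX IHp.
Qed.

Fact poly_scale1 : left_id 1 poly_scale.
Proof. by move=> v; rewrite -polyC1 poly_scaleC scale1r. Qed.

HB.instance Definition _ :=
  GRing.Zmodule_isLmodule.Build {poly K} (poly_module u)
  poly_scaleA poly_scale1 poly_scaleDr poly_scaleDl.

Lemma poly_moduleC c (v : poly_module u) : c%:P *: v = (c *: (v : V)).
Proof. exact: poly_scaleC. Qed.

Lemma poly_moduleX (v : poly_module u) : 'X *: v = u v.
Proof. by rewrite -['X]mul1r [LHS]poly_scale_mulX poly_scale1. Qed.

(** An endomorphism that commutes with u is linear over {poly K}; this allows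
    the construction to be iterated. *)
Definition poly_lift (g : {linear V -> V}) (gu : forall v, g (u v) = u (g v)) :
  poly_module u -> poly_module u := g.

Section Lift.
Variables (g : {linear V -> V}) (gu : forall v, g (u v) = u (g v)).

Fact poly_lift_linear : linear (poly_lift gu).
Proof.
move=> p v w; rewrite /poly_lift raddfD; congr (_ + _).
rewrite [LHS]raddf_sum; apply: eq_bigr => i _.
have -> : iter i u (g v) = g (iter i u v).
  by elim: (nat_of_ord i) => //= j ->; rewrite gu.
exact: linearZ_LR.
Qed.

HB.instance Definition _ := GRing.isLinear.Build {poly K} (poly_module u)
  (poly_module u) _ (poly_lift gu) poly_lift_linear.

End Lift.

End PolyModule.

(** * The module of the sequences X A^j Y *)

Section Triple.
Variables (F : fieldType) (B : algType F) (A : B).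

Definition seq_mull (s : nat -> B) : nat -> B := fun j => A * s j.
Definition seq_shift (s : nat -> B) : nat -> B := fun j => s j.+1.
Definition seq_mulr (s : nat -> B) : nat -> B := fun j => s j * A.

Fact seq_mull_linear : linear seq_mull.
Proof.
by move=> c v w; apply/funext => j; rewrite /seq_mull mulrDr -scalerAr.
Qed.

Fact seq_shift_linear : linear seq_shift.
Proof. by []. Qed.

Fact seq_mulr_linear : linear seq_mulr.
Proof.
by move=> c v w; apply/funext => j; rewrite /seq_mulr mulrDl -scalerAl.
Qed.

HB.instance Definition _ :=
  GRing.isLinear.Build F (nat -> B) (nat -> B) _ seq_mull seq_mull_linear.
HB.instance Definition _ :=
  GRing.isLinear.Build F (nat -> B) (nat -> B) _ seq_shift seq_shift_linear.
HB.instance Definition _ :=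
  GRing.isLinear.Build F (nat -> B) (nat -> B) _ seq_mulr seq_mulr_linear.

Fact seq_shift_mull s : seq_shift (seq_mull s) = seq_mull (seq_shift s).
Proof. by []. Qed.

Fact seq_mulr_mull s : seq_mulr (seq_mull s) = seq_mull (seq_mulr s).
Proof. by apply/funext => j; rewrite /seq_mulr /seq_mull mulrA. Qed.

Definition seq_shift1 : {linear poly_module seq_mull -> poly_module seq_mull} :=
  poly_lift seq_shift_mull.

Definition seq_mulr1 : {linear poly_module seq_mull -> poly_module seq_mull} :=
  poly_lift seq_mulr_mull.

Fact seq_mulr_shift1 s : seq_mulr1 (seq_shift1 s) = seq_shift1 (seq_mulr1 s).
Proof. by []. Qed.

Definition seq_mulr2 :
    {linear poly_module seq_shift1 -> poly_module seq_shift1} :=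
  poly_lift seq_mulr_shift1.

(** In X A^j Y a further A can be inserted on the left, on the right, and in the
    middle by a shift of j.  Keeping all values of j is what turns the insertion
    in the middle into an operator. *)
Definition triple_module := poly_module seq_mulr2.

HB.instance Definition _ := GRing.Lmodule.on triple_module.

Definition left_var : {poly {poly {poly F}}} := 'X%:P%:P.
Definition mid_var : {poly {poly {poly F}}} := 'X%:P.
Definition right_var : {poly {poly {poly F}}} := 'X.
Definition const3 (k : F) : {poly {poly {poly F}}} := k%:P%:P%:P.

Implicit Type s : triple_module.

Lemma left_varE s : left_var *: s = seq_mull s.
Proof. by rewrite /left_var 2!poly_moduleC poly_moduleX. Qed.

Lemma mid_varE s : mid_var *: s = seq_shift s.
Proof. by rewrite /mid_var poly_moduleC poly_moduleX. Qed.

Lemma right_varE s : right_var *: s = seq_mulr s.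
Proof. by rewrite poly_moduleX. Qed.

Lemma const3E k s : const3 k *: s = (k *: (s : nat -> B)).
Proof. by rewrite /const3 !poly_moduleC. Qed.

Definition triple (X Y : B) : triple_module := fun j : nat => X * A ^+ j * Y.

Lemma triple_a X Y : left_var *: triple X Y = triple (A * X) Y.
Proof.
by rewrite left_varE; apply/funext => j; rewrite /seq_mull /triple !mulrA.
Qed.

Lemma triple_bl X Y : mid_var *: triple X Y = triple (X * A) Y.
Proof.
rewrite mid_varE; apply/funext => j.
by rewrite /seq_shift /triple exprS !mulrA.
Qed.

Lemma triple_br X Y : mid_var *: triple X Y = triple X (A * Y).
Proof.
rewrite mid_varE; apply/funext => j.
by rewrite /seq_shift /triple exprSr !mulrA.
Qed.

Lemma triple_c X Y : right_var *: triple X Y = triple X (Y * A).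
Proof.
by rewrite right_varE; apply/funext => j; rewrite /seq_mulr /triple !mulrA.
Qed.

Lemma triple_k_l k X Y : const3 k *: triple X Y = triple (k *: X) Y.
Proof. by rewrite const3E; apply/funext => j; rewrite /triple -!scalerAl. Qed.

Lemma triple_k_r k X Y : const3 k *: triple X Y = triple X (k *: Y).
Proof. by rewrite const3E; apply/funext => j; rewrite /triple -!scalerAr. Qed.

(* [const3], in a form whose structure of ring morphism is inferred. *)
Local Notation const3_morph := (polyC \o polyC \o polyC).

Lemma triple_l Y :
  intertwines A const3_morph (triple^~ Y) left_var mid_var.
Proof.
split.
- by move=> U V; apply/funext => j; rewrite /triple !mulrBl.
- by move=> e U; rewrite -triple_k_l.
- by move=> U; rewrite triple_a.
- by move=> U; rewrite triple_bl.
Qed.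

Lemma triple_r X : intertwines A const3_morph (triple X) mid_var right_var.
Proof.
split.
- by move=> U V; apply/funext => j; rewrite /triple !mulrBr.
- by move=> e U; rewrite -triple_k_r.
- by move=> U; rewrite triple_br.
- by move=> U; rewrite triple_c.
Qed.

Definition head_term (s : triple_module) : B := s 0%N.

Lemma head_add : zmod_morphism head_term. Proof. by []. Qed.

Lemma head_k e s : head_term (const3 e *: s) = e *: head_term s.
Proof. by rewrite const3E. Qed.

Lemma head_a s : head_term (left_var *: s) = A * head_term s.
Proof. by rewrite left_varE. Qed.

Lemma head_c s : head_term (right_var *: s) = head_term s * A.
Proof. by rewrite right_varE. Qed.

Lemma head_triple X Y : head_term (triple X Y) = X * Y.
Proof. by rewrite /head_term /triple expr0 mulr1. Qed.

(** The number of steps is additive: [prod_factor_mem], applied to the sequence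
    j |-> X A^j Y and read off at j = 0. *)
Theorem prod_opM (t : F) n X Y :
  (t + 1) * (t - 1) ^+ 2 != 0 -> (0 < n)%N ->
  prod_op A t n X = 0 -> prod_op A t 2 Y = 0 -> prod_op A t n.+1 (X * Y) = 0.
Proof.
exact: (prod_opM_pairing triple_l triple_r head_add head_k head_a head_c
          head_triple).
Qed.

End Triple.

(** * Comparison with bad, and calculus of the maps ad *)

Section Bad.
Variables (F : fieldType) (q : F) (B : algType F) (A : B).
Hypothesis q_neq0 : q != 0.

Lemma ad_ad (n : nat) X : ad q n A (ad q (- n%:Z) A X) =
  A * (A * X) + X * A * A - (q ^+ (2 * n) + q ^- (2 * n)) *: (A * (X * A)).
Proof.
rewrite /ad opprK -!exprnN -exprnP; set v := q ^+ n.
have v0 : v != 0 by rewrite expf_neq0.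
have -> : q ^+ (2 * n) = v ^+ 2 by rewrite mulnC exprM.
rewrite mulrBr mulrBl !scalerBr -!(scalerAl, scalerAr) !scalerA.
rewrite mulVf // mulfV //.
rewrite !scale1r -[A * X * A]mulrA -!expr2 opprB scalerDl exprVn.
by rewrite addrACA -opprD.
Qed.

Lemma quad_op_ad (n : nat) X : quad_op A ((q ^+ 2) ^+ n) X =
  q ^+ (4 * n) *: ((q ^+ (2 * n) - q ^- (2 * n)) ^+ 2 *: X
                   + ad q n A (ad q (- n%:Z) A X)).
Proof.
rewrite -exprM ad_ad /quad_op; set u := q ^+ (2 * n).
have u0 : u != 0 by rewrite expf_neq0.
have -> : q ^+ (4 * n) = u ^+ 2 by rewrite -exprM mulnAC.
rewrite [in RHS]scalerDr [in RHS]scalerBr !scalerA [LHS]addrC.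
congr (_ + (_ - _)).
  by congr (_ *: _); field.
by congr (_ *: _); field.
Qed.

Lemma bad_factor_op (n : nat) :
  exists k, forall X, bad q n A X = k *: factor_op A (q ^+ 2) n X.
Proof.
case: n => [|n].
  by exists (q - q^-1)^-1 => X; rewrite /bad /ad oppr0 expr0z !scale1r.
eexists => X; rewrite /factor_op quad_op_ad scalerA /bad.
have q4_neq0 := expf_neq0 (4 * n.+1) q_neq0.
congr (_ *: _); rewrite -[LHS]mul1r -[X in X * _](mulVf q4_neq0).
by rewrite mulrAC; reflexivity.
Qed.

Lemma factor_opZ t n k X : factor_op A t n (k *: X) = k *: factor_op A t n X.
Proof.
case: n => [|n] /=; first by rewrite scalerBr -scalerAl -scalerAr.
rewrite /quad_op -!(scalerAl, scalerAr) -[k *: _ + k *: _]scalerDr.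
by rewrite [in RHS]scalerDr [in RHS]scalerBr !scalerA ![_ * k]mulrC.
Qed.

Lemma bad_prod_op n :
  exists k, forall X, bad_prod q A n X = k *: prod_op A (q ^+ 2) n X.
Proof.
rewrite /bad_prod /prod_op /index_iota subn0.
elim: (iota 0 n) => [|i s [k IHs]].
  by exists 1 => X; rewrite big_nil scale1r.
have [k' def_bad] := bad_factor_op i.
by exists (k' * k) => X; rewrite big_cons /= def_bad IHs factor_opZ scalerA.
Qed.

Lemma adD r : {morph ad q r A : X Y / X + Y}.
Proof. by move=> X Y; rewrite /ad mulrDr mulrDl !scalerDr opprD addrACA. Qed.

Lemma adZ r k X : ad q r A (k *: X) = k *: ad q r A X.
Proof.
by rewrite /ad -scalerAr -scalerAl scalerBr !scalerA ![_ * k]mulrC.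
Qed.

Lemma adN r : {morph ad q r A : X / - X}.
Proof. by move=> X; rewrite -scaleN1r adZ scaleN1r. Qed.

Lemma adB r : {morph ad q r A : X Y / X - Y}.
Proof. by move=> X Y; rewrite adD adN. Qed.

Lemma adC r s X : ad q r A (ad q s A X) = ad q s A (ad q r A X).
Proof.
rewrite /ad !mulrBr !mulrBl !scalerBr -!(scalerAl, scalerAr) !scalerA !mulrA.
rewrite ![q ^ s * _]mulrC ![q ^ (- s) * _]mulrC.
by rewrite !opprB [LHS]addrACA [RHS]addrACA; congr (_ + _); rewrite addrC.
Qed.

Lemma ad1DadN1 X : ad q 1 A X + ad q (- 1) A X = (q + q^-1) *: ad q 0 A X.
Proof.
rewrite /ad opprK oppr0 expr0z !scale1r -exprnN expr1z expr1.
by rewrite scalerBr !scalerDl opprD addrACA [- (q *: _) - _]addrC.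
Qed.

Lemma ad0E X : ad q 0 A X = commutator A X.
Proof. by rewrite /ad oppr0 expr0z !scale1r. Qed.

Lemma ad1E X : ad q 1 A X = q_commutator q A X.
Proof. by rewrite /ad -exprnN expr1z expr1. Qed.

Lemma adN1E X : ad q (- 1) A X = - q_commutator q X A.
Proof. by rewrite /ad opprK -exprnN expr1z expr1 opprB. Qed.

End Bad.

(** * Elements that are killed after two steps *)

Section TwoSteps.
Variables (F : fieldType) (q : F) (B : algType F) (A : B).
Hypothesis q_neq0 : q != 0.
Hypothesis qq_neq0 : q + q^-1 != 0.

Lemma prod_op2_eq0 X :
  ad q 0 A ((q ^+ 2 - q ^- 2) ^+ 2 *: X + ad q 1 A (ad q (- 1) A X)) = 0 ->
  prod_op A (q ^+ 2) 2 X = 0.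
Proof.
rewrite /prod_op [iota _ _]/= [foldr _ _ _]/= (quad_op_ad A q_neq0 1).
rewrite -/(commutator A _) -(ad0E q) adZ muln1.
by move=> ->; rewrite scaler0.
Qed.

Lemma prod_op2_comm X : ad q 0 A X = 0 -> prod_op A (q ^+ 2) 2 X = 0.
Proof.
have ad_0 r : ad q r A 0 = 0 by rewrite -(scale0r (1 : B)) adZ !scale0r.
move=> X0; apply: prod_op2_eq0.
by rewrite adD adZ adC [ad q 0 A (ad q _ A _)]adC X0 !ad_0 scaler0 addr0.
Qed.

(* V = W_(-k-1), W = W_(k+1), G = G_(k+1) and Gt = Gt_(k+1). *)
Variables W V G Gt : B.
Variable r : F.
Hypothesis r_def : (q ^+ 2 - q ^- 2) ^+ 2 = - r.
Hypothesis ad_W : ad q 0 A W = (q + q^-1)^-1 *: (Gt - G).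
Hypothesis ad_V : ad q 0 A V = 0.
Hypothesis ad_G : ad q 1 A G = r *: (V - W).
Hypothesis ad_Gt : ad q (- 1) A Gt = - r *: (V - W).

Let ad_D : ad q 0 A (V - W) = - ((q + q^-1)^-1 *: (Gt - G)).
Proof. by rewrite adB ad_V ad_W sub0r. Qed.

(** The commutator with A carries W to a multiple of Gt - G.  On Gt - G the
    product of ad_1 A and ad_(-1) A is the scalar r: it leads to V - W, and from
    there ad_1 A + ad_(-1) A, a multiple of ad A, leads back. *)
Lemma prod_op2_W : prod_op A (q ^+ 2) 2 W = 0.
Proof.
apply: prod_op2_eq0.
have ad_ad_diff : ad q 1 A (ad q (- 1) A (Gt - G)) = r *: (Gt - G).
  rewrite [ad q (- 1) A _]adB adB [ad q 1 A (ad q _ A G)]adC ad_Gt ad_G 2!adZ.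
  rewrite scaleNr -opprD -scalerDr ad1DadN1 // ad_D.
  by rewrite scalerN scalerA divff // scale1r scalerN opprK.
rewrite adD adZ adC [ad q 0 A (ad q _ A W)]adC ad_W 2!adZ ad_ad_diff.
by rewrite !scalerA [_^-1 * _]mulrC -scalerDl -mulrDl r_def addNr mul0r scale0r.
Qed.

(** ad_1 A carries G to a multiple of V - W, and the commutator with A carries
    V - W to a multiple of Gt - G.  The remaining map ad_(-1) A is known on Gt,
    and [ad1DadN1] gives it on G up to a multiple of V - W, which cancels. *)
Lemma prod_op2_G : prod_op A (q ^+ 2) 2 G = 0.
Proof.
apply: prod_op2_eq0.
have ad_nG : ad q (- 1) A G = (q + q^-1) *: ad q 0 A G - r *: (V - W).
  by rewrite -ad1DadN1 ad_G addrC addKr.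
rewrite adD adZ [ad q 1 A _]adC ad_G adZ adZ adC ad_D.
rewrite adN adZ adB ad_Gt ad_nG.
rewrite scaleNr -opprD [r *: _ + _]addrC subrK.
rewrite -!scalerN opprK !scalerA mulrA mulfVK // -scalerDl.
by rewrite r_def addNr scale0r.
Qed.

Lemma prod_op2_Gt : prod_op A (q ^+ 2) 2 Gt = 0.
Proof.
apply: prod_op2_eq0.
have ad_pGt : ad q 1 A Gt = (q + q^-1) *: ad q 0 A Gt + r *: (V - W).
  by rewrite -ad1DadN1 ad_Gt scaleNr subrK.
rewrite adD adZ ad_Gt adZ adZ adC ad_D.
rewrite adN adZ adB ad_pGt ad_G addrK.
by rewrite scalerN scaleNr opprK !scalerA mulfVK // r_def scaleNr addNr.
Qed.

End TwoSteps.

(** * Linearity and monotonicity of the products of factors *)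

Section Filtration.
Variables (F : fieldType) (B : algType F) (A : B) (t : F).
Hypothesis t_gen : (t + 1) * (t - 1) ^+ 2 != 0.

Lemma quad_opD u X Y : quad_op A u (X + Y) = quad_op A u X + quad_op A u Y.
Proof.
rewrite /quad_op !mulrDl !mulrDr [A * _ + _ + _]addrACA.
set P := A * _ + _.
rewrite (scalerDr _ P) (scalerDr _ (A * (X * A))) (scalerDr _ X).
by rewrite opprD [X in X + _ = _]addrACA [LHS]addrACA.
Qed.

Lemma prod_opD n X Y :
  prod_op A t n (X + Y) = prod_op A t n X + prod_op A t n Y.
Proof.
rewrite /prod_op; elim: (iota 0 n) => //= -[|i] s -> /=; last exact: quad_opD.
by rewrite mulrDl mulrDr opprD addrACA.
Qed.

Lemma prod_opZ n k X : prod_op A t n (k *: X) = k *: prod_op A t n X.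
Proof.
by rewrite /prod_op; elim: (iota 0 n) => //= i s ->; rewrite factor_opZ.
Qed.

Lemma prod_op0 n : prod_op A t n 0 = 0.
Proof. by have := prod_opZ n 0 0; rewrite !scale0r. Qed.

Lemma prod_op2_1 : prod_op A t 2 1 = 0.
Proof.
rewrite /prod_op /= /quad_op !mulr1 !mul1r mulrDr mulrBr mulrDl mulrBl.
by rewrite -!(scalerAl, scalerAr) mulr1 mul1r !mulrDr !mulrDl !mulrA subrr.
Qed.

(** The step from m to m + 1 is [prod_opM] for the product X * 1. *)
Lemma prod_op_mono m n X :
  (0 < m <= n)%N -> prod_op A t m X = 0 -> prod_op A t n X = 0.
Proof.
case/andP=> m_gt0 /subnK <-; elim: (n - m)%N => //= d IHd X0.
rewrite -[X]mulr1; apply: prod_opM (IHd X0) prod_op2_1 => //.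
by rewrite addn_gt0 m_gt0 orbT.
Qed.

End Filtration.

(** * The current algebra *)

Section Quotient.
Variables (F : fieldType) (q : F) (B : algType F) (I : two_sided_ideal B).

Lemma alg_projB (x y : B) : alg_proj I (x - y) = alg_proj I x - alg_proj I y.
Proof. by rewrite alg_projD -scaleN1r alg_projZ scaleN1r. Qed.

Lemma alg_proj_commutator (x y : B) :
  alg_proj I (commutator x y) = commutator (alg_proj I x) (alg_proj I y).
Proof. by rewrite /commutator alg_projB !alg_projM. Qed.

Lemma alg_proj_q_commutator (x y : B) :
  alg_proj I (q_commutator q x y) =
  q_commutator q (alg_proj I x) (alg_proj I y).
Proof. by rewrite /q_commutator alg_projB !alg_projZ !alg_projM. Qed.

End Quotient.

Section Current.
Variables (F : fieldType) (q : F).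
Hypothesis q_neq0 : q != 0.
Hypothesis q_not_root : forall n : nat, (0 < n)%N -> ~~ n.-unity_root q.

Lemma expq_neq1 n : (0 < n)%N -> q ^+ n != 1.
Proof. by move/q_not_root; rewrite unity_rootE. Qed.

(** The scalar of [prod_factor_mem]; its factors divide q^4 - 1. *)
Lemma q2_gen : (q ^+ 2 + 1) * (q ^+ 2 - 1) ^+ 2 != 0.
Proof.
have := expq_neq1 (isT : 0 < 4)%N; rewrite -subr_eq0.
have -> : q ^+ 4 - 1 = (q ^+ 2 + 1) * (q ^+ 2 - 1) by ring.
by rewrite mulf_eq0 negb_or => /andP[h1 h2]; rewrite mulf_neq0 ?expf_neq0.
Qed.

Lemma qDVq_neq0 : q + q^-1 != 0.
Proof.
have := q2_gen; apply: contraNneq => /(congr1 ( *%R q)).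
by rewrite mulrDr divff // -expr2 mulr0 => ->; rewrite mul0r.
Qed.

Local Notation C := (current_algebra q).
Local Notation A := (current_Wm q 0).

Lemma current_relP l r :
  current_rel q l r -> current_proj q l = current_proj q r.
Proof. by move=> lr; apply/alg_projP/gen_idealP/gen_ideal_rel. Qed.

Lemma current_projD x y :
  current_proj q (x + y) = current_proj q x + current_proj q y.
Proof. exact: alg_projD. Qed.

Lemma current_projZ k x : current_proj q (k *: x) = k *: current_proj q x.
Proof. exact: alg_projZ. Qed.

Lemma current_projM x y :
  current_proj q (x * y) = current_proj q x * current_proj q y.
Proof. exact: alg_projM. Qed.

Lemma current_proj0 : current_proj q 0 = 0.
Proof. exact: alg_proj0. Qed.

Lemma current_projB x y :
  current_proj q (x - y) = current_proj q x - current_proj q y.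
Proof. exact: alg_projB. Qed.

Lemma proj_commutator x y :
  current_proj q (commutator x y) =
  commutator (current_proj q x) (current_proj q y).
Proof. exact: alg_proj_commutator. Qed.

Lemma proj_q_commutator x y :
  current_proj q (q_commutator q x y) =
  q_commutator q (current_proj q x) (current_proj q y).
Proof. exact: alg_proj_q_commutator. Qed.

Lemma prod_op2_gen g : prod_op A (q ^+ 2) 2 (current_proj q (free_gen F g)) = 0.
Proof.
have ad_Wm k : ad q 0 A (current_Wm q k) = 0.
  rewrite ad0E -proj_commutator (current_relP (rel_Wm_Wm q 0 k)).
  exact: current_proj0.
have ad_Wp k : ad q 0 A (current_Wp q k) =
    (q + q^-1)^-1 *: (current_Gt q k - current_G q k).
  rewrite ad0E -proj_commutator (current_relP (rel_W0_Wp q k)).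
  by rewrite (current_relP (rel_Wm_W1 q k)) current_projZ current_projB.
have ad_Gt k : q_commutator q (current_Gt q k) A =
    rho q *: (current_Wm q k.+1 - current_Wp q k).
  rewrite -proj_q_commutator (current_relP (rel_Gt_W0 q k)) -scalerBr.
  by rewrite current_projZ current_projB.
have ad_G k : ad q 1 A (current_G q k) =
    rho q *: (current_Wm q k.+1 - current_Wp q k).
  rewrite ad1E -proj_q_commutator (current_relP (rel_W0_G q k)).
  by rewrite proj_q_commutator; exact: ad_Gt.
have ad_nGt k : ad q (- 1) A (current_Gt q k) =
    - rho q *: (current_Wm q k.+1 - current_Wp q k).
  by rewrite adN1E ad_Gt -scaleNr.
have r_def : (q ^+ 2 - q ^- 2) ^+ 2 = - rho q by rewrite /rho opprK.
case: g => k.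
- exact: (prod_op2_comm q_neq0 (ad_Wm k)).
- exact: (prod_op2_W q_neq0 qDVq_neq0 r_def (ad_Wp k) (ad_Wm k.+1)
          (ad_G k) (ad_nGt k)).
- exact: (prod_op2_G q_neq0 qDVq_neq0 r_def (ad_Wp k) (ad_Wm k.+1)
          (ad_G k) (ad_nGt k)).
exact: (prod_op2_Gt q_neq0 qDVq_neq0 r_def (ad_Wp k) (ad_Wm k.+1)
          (ad_G k) (ad_nGt k)).
Qed.

Lemma prod_op_word (s : seq current_gen) :
  prod_op A (q ^+ 2) (size s).+2 (current_proj q << FMonom s >>) = 0.
Proof.
elim/last_ind: s => [|s g IHs].
  have -> : << FMonom [::] >> = 1 :> free_alg F current_gen by rewrite -fmoneE.
  exact: prod_op2_1.
have -> : << FMonom (rcons s g) >> = << FMonom s >> * free_gen F g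
    :> free_alg F current_gen.
  rewrite malgM_def fgmulUU mulr1 -cats1 fmuE.
  by congr << _ *g _ >>; exact/esym/(fmmulE (FMonom s) (FMonom [:: g])).
rewrite size_rcons current_projM.
exact: (prod_opM q2_gen (n := (size s).+2) isT IHs (prod_op2_gen g)).
Qed.

Lemma prod_op_eventually (X : C) :
  exists2 n, (0 < n)%N & prod_op A (q ^+ 2) n X = 0.
Proof.
elim/alg_projW: X => x; rewrite -/(current_proj q x) (monalgE x).
elim: (enum_fset (msupp x)) => [|k s [n n_gt0 IHs]].
  by exists 2 => //; rewrite big_nil current_proj0; exact: prod_op0.
rewrite big_cons current_projD.
exists (maxn (size k).+2 n); first by rewrite leq_max.
rewrite prod_opD (prod_op_mono q2_gen _ IHs) ?n_gt0 ?leq_maxr // addr0.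
have le_k : (0 < (size k).+2 <= maxn (size k).+2 n)%N by rewrite leq_maxl.
have -> : << x@_k *g k >> = x@_k *: (<< k >> : free_alg F current_gen).
  by apply/malgP => m; rewrite mcoeffZ !mcoeffU mulrnAr mulr1.
rewrite current_projZ prod_opZ (prod_op_mono q2_gen le_k) ?scaler0 //.
by rewrite -[k in << k >>]fmK; exact: prod_op_word.
Qed.

End Current.

Theorem proposition7p3 (F : fieldType) (q : F)
    (q_neq0 : q != 0)
    (q_not_root : forall n : nat, (0 < n)%N -> ~~ n.-unity_root q) :
  standard_algebra q (current_Wm q 0).
Proof.
move=> X; have [n n_gt0 X0] := prod_op_eventually q_neq0 q_not_root X.
have [k bad_n] := bad_prod_op (current_Wm q 0) q_neq0 n.
by exists n; rewrite bad_n X0 scaler0.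
Qed.
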